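(* Let $k$ be a field, $n\ge1$ an integer, $q=(q_{ij})$ a multiplicatively antisymmetric $n\times n$ matrix over $k^\times$, $L=k_q[[x_1^{\pm1},\ldots,x_n^{\pm1}]]$ the $q$-commutative Laurent series ring, and $Z$ the center of $L$. The assignments $P\mapsto P\cap Z$, for $P\in\operatorname{Spec}L$, and $Q\mapsto LQ$, for $Q\in\operatorname{Spec}Z$, provide mutually inverse homeomorphisms between $\operatorname{Spec}L$ and $\operatorname{Spec}Z$.
   Context: Multiplicatively antisymmetric means $q_{ii}=1$ and $q_{ij}=q_{ji}^{-1}\in k^\times$ for all $i,j$. Let $R=k_q[[x_1,\ldots,x_n]]$ be the associative unital $k$-algebra of formal skew power series $\sum_{s\in\mathbb{N}^n} c_s x^s$ ($c_s\in k$, $x^s=x_1^{s_1}\cdots x_n^{s_n}$, $\mathbb{N}$ the non-negative integers), with multiplication determined by $x_ix_j=q_{ij}x_jx_i$. It is a noetherian domain and each $x_i$ is normal. The $q$-commutative Laurent series ring $L$ is the Ore localization of $R$ at the multiplicatively closed set generated by $1,x_1,\ldots,x_n$; its elements are the series $\sum_{s\in\mathbb{Z}^n}c_sx^s$, $c_s\in k$, with $c_s=0$ for $\min\{s_1,\ldots,s_n\}\ll0$. For any ring, $\operatorname{Spec}$ denotes its set of (two-sided) prime ideals with the Zariski topology (closed sets: the sets of primes containing a given ideal). *)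

(* Defs.v *)
From HB Require Import structures.
From mathcomp Require Import all_boot all_order all_algebra.
From mathcomp Require Import ring zify.
From mathcomp Require Import all_classical topology.

Set Implicit Arguments.
Unset Strict Implicit.
Unset Printing Implicit Defensive.

Import Order.TTheory GRing.Theory Num.Theory.
Local Open Scope classical_set_scope.
Local Open Scope ring_scope.

Section Ideals.
Variable A : pzRingType.
Implicit Types I J P S : set A.

(** Ideals are two-sided; the rings need not be commutative. *)
Definition ideal I :=
  [/\ I 0, forall x y, I x -> I y -> I (x + y)
    & forall a x, I x -> I (a * x) /\ I (x * a)].

Definition prime_ideal P :=
  [/\ ideal P, P != setT
    & forall I J, ideal I -> ideal J ->
        (forall x y, I x -> J y -> P (x * y)) -> I `<=` P \/ J `<=` P].

Definition ideal_gen S : set A :=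
  [set x | forall I, ideal I -> S `<=` I -> I x].

Lemma ideal_gen_ideal S : ideal (ideal_gen S).
Proof.
split.
- by move=> I [].
- by move=> x y Ix Iy I idI SI; case: (idI) => _ + _; apply; [exact: Ix|exact: Iy].
- by move=> a x Ix; split=> I idI SI; case: (idI) => _ _ /(_ a x (Ix I idI SI))[].
Qed.

Lemma sub_ideal_gen S : S `<=` ideal_gen S.
Proof. by move=> x Sx I _; apply. Qed.

Lemma ideal_gen_sub S I : ideal I -> S `<=` I -> ideal_gen S `<=` I.
Proof. by move=> idI SI x; apply. Qed.

Record Spec := MkSpec { Spec_set :> set A; Spec_prime : prime_ideal Spec_set }.

End Ideals.

HB.instance Definition _ (A : pzRingType) := gen_eqMixin (Spec A).
HB.instance Definition _ (A : pzRingType) := gen_choiceMixin (Spec A).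

Section Zariski.
Variable A : pzRingType.

Definition Vset (I : set A) : set (Spec A) := [set P : Spec A | I `<=` P].

Definition Zariski_open (U : set (Spec A)) :=
  exists2 I : set A, ideal I & U = ~` Vset I.

Let openT : Zariski_open setT.
Proof.
exists setT; first by split.
apply/seteqP; split=> // P _ /= PT.
by have [_ /eqP PnT _] := Spec_prime P; apply: PnT; apply/seteqP; split.
Qed.

Let openI : setI_closed Zariski_open.
Proof.
move=> _ _ [I idI ->] [J idJ ->].
exists (ideal_gen [set z | exists x y, [/\ I x, J y & z = x * y]]).
  exact: ideal_gen_ideal.
rewrite -setCU; congr (~` _); apply/seteqP; split=> P /=.
  have [_ _ IJ] := idI; have [_ _ JI] := idJ.
  have [idP _ _] := Spec_prime P.
  case=> sub; apply: ideal_gen_sub => // _ [x [y [Ix Jy ->]]]; apply: sub.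
    by have [] := IJ y _ Ix.
  by have [] := JI x _ Jy.
move=> sub; have [_ _ pP] := Spec_prime P.
apply: pP => // x y Ix Jy; apply: sub; apply: sub_ideal_gen.
by exists x, y.
Qed.

Let open_bigU (T : Type) (f : T -> set (Spec A)) :
  (forall i, Zariski_open (f i)) -> Zariski_open (\bigcup_i f i).
Proof.
move=> fop.
exists (ideal_gen [set x | exists i J, [/\ ideal J, f i = ~` Vset J & J x]]).
  exact: ideal_gen_ideal.
rewrite -[LHS]setCK setC_bigcup; congr (~` _); apply/seteqP; split=> P /=.
  move=> fP; have [idP _ _] := Spec_prime P; apply: ideal_gen_sub => //.
  move=> x [i [J [idJ fi Jx]]]; have := fP i Logic.I.
  by rewrite fi setCK; apply.
move=> sub i _; have [J idJ fi] := fop i; rewrite fi /= notK => x Jx.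
by apply: sub; apply: sub_ideal_gen; exists i, J.
Qed.

HB.instance Definition _ :=
  isOpenTopological.Build (Spec A) openT openI open_bigU.

Lemma Spec_openE (U : set (Spec A)) : open U = Zariski_open U.
Proof. by []. Qed.

End Zariski.

Section Center.
Variable A : pzRingType.

Definition is_central : {pred A} := fun x => `[< forall y : A, x * y = y * x >].

Record center := Center { center_val :> A; centerP : center_val \in is_central }.

HB.instance Definition _ := [isSub for center_val].
HB.instance Definition _ := [Choice of center by <:].

Let is_central_subring : subring_closed is_central.
Proof.
split.
- by apply/asboolP => y; rewrite mul1r mulr1.
- move=> x y /asboolP cx /asboolP cy; apply/asboolP => z.
  by rewrite mulrBl mulrBr cx cy.
- move=> x y /asboolP cx /asboolP cy; apply/asboolP => z.
  by rewrite -mulrA cy mulrA cx mulrA.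
Qed.

HB.instance Definition _ :=
  GRing.SubChoice_isSubPzRing.Build A is_central center is_central_subring.

Let center_mulC : commutative (@GRing.mul center).
Proof.
move=> x y; apply: val_inj; rewrite !rmorphM /=.
by have /asboolP := centerP x; apply.
Qed.

HB.instance Definition _ := GRing.PzRing_hasCommutativeMul.Build center center_mulC.

(** [P :&: Z], seen as a subset of the ring [Z] *)
Definition contract (P : set A) : set center := [set z | P (val z)].

(** [A Q], the set of finite sums of products [a z] with [a] in [A], [z] in [Q] *)
Definition extend (Q : set center) : set A :=
  [set x | exists m (a : 'I_m -> A) (z : 'I_m -> center),
     (forall i, Q (z i)) /\ x = \sum_(i < m) a i * val (z i)].

End Center.

Definition mult_antisym (k : fieldType) (n : nat) (q : 'M[k]_n) :=
  [/\ forall i, q i i = 1, forall i j, q i j != 0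
    & forall i j, q i j = (q j i)^-1].

Notation exponent n := {ffun 'I_n -> int}.

Section LaurentSeries.
Variables (k : fieldType) (n : nat) (q : 'M[k]_n).

(** The coefficients [c_s] vanish as soon as [min (s_1, .., s_n)] is small enough *)
Definition laurent_bounded : {pred exponent n -> k} := fun c =>
  `[< exists m : int, forall s : exponent n, (exists i, s i < m) -> c s = 0 >].

(** The scalar such that [x^s x^t = qcocycle s t * x^(s+t)]: moving [x_j^(t_j)]
    to the left of [x_i^(s_i)], for [j < i], contributes [q_ij ^ (s_i t_j)]. *)
Definition qcocycle (s t : exponent n) : k :=
  \prod_(i < n) \prod_(j < n | (j < i)%N) q i j ^ (s i * t j).

(** [q] and the proof [hq] are kept as parameters since the ring structure below
    depends on them. *)
Record qlaurent (hq : mult_antisym q) := QLaurent {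
  coef :> exponent n -> k;
  coef_bounded : coef \in laurent_bounded }.

Variable hq : mult_antisym q.
Local Notation L := (qlaurent hq).

HB.instance Definition _ := [isSub for (@coef hq)].
HB.instance Definition _ := [Choice of L by <:].

Let laurent_zmod_closed : zmod_closed laurent_bounded.
Proof.
split; first by apply/asboolP; exists 0.
move=> f g /asboolP[a fa] /asboolP[b gb]; apply/asboolP.
exists (Num.min a b) => s [i]; rewrite lt_min => /andP[sa sb].
have -> : (f - g) s = f s - g s by [].
by rewrite fa ?gb ?subr0 //; exists i.
Qed.

HB.instance Definition _ :=
  GRing.SubChoice_isSubZmodule.Build _ laurent_bounded L laurent_zmod_closed.

Lemma qlaurentP (f g : L) : (forall s, f s = g s) -> f = g.
Proof. by move=> fg; apply: val_inj; apply/funext. Qed.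

Lemma coefD (f g : L) s : (f + g) s = f s + g s.
Proof. by []. Qed.

Lemma coef_lb (f : L) :
  exists m : int, forall s, f s != 0 -> forall i, m <= s i.
Proof.
have /asboolP[m fm] := coef_bounded f; exists m => s fs i.
by rewrite leNgt; apply: contra fs => si; rewrite fm //; exists i.
Qed.

Lemma finite_box (a b : exponent n) :
  finite_set [set s : exponent n | forall i, a i <= s i <= b i].
Proof.
pose N := (\sum_(i < n) `|b i - a i|)%N.
pose h (e : {ffun 'I_n -> 'I_N.+1}) : exponent n := [ffun i => a i + (e i : nat)%:Z].
apply: (@sub_finite_set _ _ (h @` setT)); last exact: finite_image.
move=> s /= sab; exists [ffun i => inord `|s i - a i|%N] => //.
apply/ffunP => i; rewrite !ffunE inordK.
  by have /andP[si _] := sab i; rewrite gez0_abs ?subr_ge0 // addrCA subrr addr0.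
rewrite ltnS /N (bigD1 i) //= (leq_trans _ (leq_addr _ _)) //.
have /andP[ai bi] := sab i; rewrite -lez_nat !gez0_abs ?subr_ge0 ?lerB //.
exact: le_trans bi.
Qed.

Definition lmul_fun (f g : exponent n -> k) : exponent n -> k := fun u =>
  \sum_(s \in [set: exponent n]) qcocycle s (u - s) * f s * g (u - s).

Lemma lmul_fun_bounded (f g : L) : lmul_fun f g \in laurent_bounded.
Proof.
have [a fa] := coef_lb f; have [b gb] := coef_lb g.
apply/asboolP; exists (a + b) => u [i ui]; apply: fsbig1 => s _.
apply/eqP; rewrite mulf_eq0; apply/norP => -[].
rewrite mulf_eq0 => /norP[_ /fa/(_ i) si] /gb/(_ i); rewrite !ffunE => ti.
by have := lerD si ti; rewrite addrCA subrr addr0 leNgt ui.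
Qed.

Definition lmul (f g : L) : L := QLaurent hq (lmul_fun_bounded f g).

Definition lmono_fun (c : k) (s : exponent n) : exponent n -> k :=
  fun u => if u == s then c else 0.

Lemma lmono_bounded c s : lmono_fun c s \in laurent_bounded.
Proof.
apply/asboolP; exists (- (\sum_(i < n) `|s i|)%N%:Z) => u [i]; rewrite /lmono_fun.
case: eqP => [->|//]; rewrite ltNge; case/negP.
rewrite lerNl; apply: le_trans (ler_norm _) _; rewrite normrN -abszE lez_nat.
by rewrite (bigD1 i) //= leq_addr.
Qed.

(** The monomial [c x^s] *)
Definition lmono (c : k) (s : exponent n) : L := QLaurent hq (lmono_bounded c s).

Definition lone : L := lmono 1 0.

Let qU i j : q i j \is a GRing.unit.
Proof. by case: hq => _ q0 _; rewrite unitfE. Qed.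

Lemma qcocycleDl s s' t : qcocycle (s + s') t = qcocycle s t * qcocycle s' t.
Proof.
rewrite /qcocycle -big_split; apply: eq_bigr => i _; rewrite -big_split.
by apply: eq_bigr => j _; rewrite ffunE mulrDl expfzDr // -unitfE.
Qed.

Lemma qcocycleDr s t t' : qcocycle s (t + t') = qcocycle s t * qcocycle s t'.
Proof.
rewrite /qcocycle -big_split; apply: eq_bigr => i _; rewrite -big_split.
by apply: eq_bigr => j _; rewrite ffunE mulrDr expfzDr // -unitfE.
Qed.

Lemma qcocycle0l t : qcocycle 0 t = 1.
Proof. by rewrite /qcocycle !big1 // => i _; rewrite big1 // => j _; rewrite ffunE mul0r. Qed.

Lemma qcocycle0r s : qcocycle s 0 = 1.
Proof. by rewrite /qcocycle !big1 // => i _; rewrite big1 // => j _; rewrite ffunE mulr0. Qed.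

Lemma qcocycle_neq0 s t : qcocycle s t != 0.
Proof.
apply/prodf_neq0 => i _; apply/prodf_neq0 => j _.
by rewrite -unitfE; apply: unitrXz.
Qed.

Let fsum_restrict (D : set (exponent n)) (F : exponent n -> k) :
  (forall s, F s != 0 -> D s) ->
  \sum_(s \in [set: exponent n]) F s = \sum_(s \in D) F s.
Proof.
move=> FD; apply/esym/fsbig_widen => // s [_ nDs] /=; apply/eqP.
by apply: contra_notT nDs; apply: FD.
Qed.

Let mul3_neq0 (a b c : k) : a * b * c != 0 -> b != 0 /\ c != 0.
Proof. by rewrite !mulf_eq0 => /norP[/norP[_ ->] ->]. Qed.

Let conv_box (f g : L) : exists (a b : int), forall s u,
  f s != 0 -> g (u - s) != 0 -> forall i, a <= s i <= u i - b.
Proof.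
have [a fa] := coef_lb f; have [b gb] := coef_lb g.
exists a, b => s u fs gs i; rewrite fa //=.
by have := gb _ gs i; rewrite !ffunE lerBrDr lerBrDl addrC.
Qed.

Lemma lmulE (f g : L) u : lmul f g u =
  \sum_(s \in [set: exponent n]) qcocycle s (u - s) * f s * g (u - s).
Proof. by []. Qed.

Lemma lmulDl : left_distributive lmul +%R.
Proof.
move=> f g h; apply: qlaurentP => u; rewrite coefD !lmulE.
have [a [b fh]] := conv_box f h; have [a' [b' gh]] := conv_box g h.
pose D := [set s : exponent n | forall i, ([ffun=> a] : exponent n) i <= s i <= ([ffun i => u i - b] : exponent n) i]
  `|` [set s : exponent n | forall i, ([ffun=> a'] : exponent n) i <= s i <= ([ffun i => u i - b'] : exponent n) i].
have finD : finite_set D by rewrite finite_setU; split; apply: finite_box.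
have fD s : f s != 0 -> h (u - s) != 0 -> D s.
  by move=> fs hs; left => i; rewrite !ffunE; apply: fh.
have gD s : g s != 0 -> h (u - s) != 0 -> D s.
  by move=> gs hs; right => i; rewrite !ffunE; apply: gh.
rewrite !(@fsum_restrict D); first last.
- move=> s /mul3_neq0[+ hs]; rewrite coefD; have [->|fs _] := eqVneq (f s) 0.
    by rewrite add0r => gs; apply: gD.
  exact: fD.
- by move=> s /mul3_neq0[fs hs]; apply: fD.
- by move=> s /mul3_neq0[gs hs]; apply: gD.
by rewrite -fsbig_split //; apply: eq_fsbigr => s _; rewrite coefD mulrDr mulrDl.
Qed.

Lemma lmulDr : right_distributive lmul +%R.
Proof.
move=> f g h; apply: qlaurentP => u; rewrite coefD !lmulE.
have [a [b fg]] := conv_box f g; have [a' [b' fh]] := conv_box f h.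
pose D := [set s : exponent n | forall i, ([ffun=> a] : exponent n) i <= s i <= ([ffun i => u i - b] : exponent n) i]
  `|` [set s : exponent n | forall i, ([ffun=> a'] : exponent n) i <= s i <= ([ffun i => u i - b'] : exponent n) i].
have finD : finite_set D by rewrite finite_setU; split; apply: finite_box.
have gD s : f s != 0 -> g (u - s) != 0 -> D s.
  by move=> fs hs; left => i; rewrite !ffunE; apply: fg.
have hD s : f s != 0 -> h (u - s) != 0 -> D s.
  by move=> gs hs; right => i; rewrite !ffunE; apply: fh.
rewrite !(@fsum_restrict D); first last.
- move=> s /mul3_neq0[fs]; rewrite coefD; have [->|gs _] := eqVneq (g (u - s)) 0.
    by rewrite add0r => hs; apply: hD.
  exact: gD.
- by move=> s /mul3_neq0[fs gs]; apply: gD.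
- by move=> s /mul3_neq0[fs hs]; apply: hD.
by rewrite -fsbig_split //; apply: eq_fsbigr => s _; rewrite coefD mulrDr.
Qed.

Lemma lmono_mull c s (g : L) u :
  lmul (lmono c s) g u = qcocycle s (u - s) * c * g (u - s).
Proof.
rewrite lmulE (@fsum_restrict [set s]) ?fsbig_set1 /= /lmono_fun ?eqxx // => t.
by case/mul3_neq0; rewrite /= /lmono_fun; case: (t =P s) => // _; rewrite eqxx.
Qed.

Lemma lmono_mulr c s (g : L) u :
  lmul g (lmono c s) u = qcocycle (u - s) s * g (u - s) * c.
Proof.
rewrite lmulE (@fsum_restrict [set u - s]).
  by rewrite fsbig_set1 /= /lmono_fun opprB addrCA subrr addr0 eqxx.
move=> t /mul3_neq0[_] /=; rewrite /lmono_fun.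
by case: (u - t =P s) => [<-|]; rewrite ?eqxx // opprB addrCA subrr addr0.
Qed.

Lemma lmul1l : left_id lone lmul.
Proof.
by move=> g; apply: qlaurentP => u; rewrite lmono_mull subr0 qcocycle0l !mul1r.
Qed.

Lemma lmul1r : right_id lone lmul.
Proof.
by move=> g; apply: qlaurentP => u; rewrite lmono_mulr subr0 qcocycle0r mul1r mulr1.
Qed.

Lemma lmulA : associative lmul.
Proof.
move=> f g h; apply: qlaurentP => u; rewrite !lmulE.
have [a fa] := coef_lb f; have [b gb] := coef_lb g; have [c hc] := coef_lb h.
pose K : set (exponent n) := [set s : exponent n | forall i,
  ([ffun=> a] : exponent n) i <= s i <= ([ffun i => u i - b - c] : exponent n) i].
pose M : set (exponent n) := [set s : exponent n | forall i,
  ([ffun=> a + b] : exponent n) i <= s i <= ([ffun i => u i - c] : exponent n) i].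
have finK : finite_set K by apply: finite_box.
have finM : finite_set M by apply: finite_box.
pose G (r s : exponent n) : k := qcocycle r (s - r) * qcocycle s (u - s) * f r * g (s - r) * h (u - s).
have GKM (r s : exponent n) : G r s != 0 -> K r /\ M s.
  rewrite /G !mulf_eq0 => /norP[/norP[/norP[_ fr] gsr] hus].
  have E i : [/\ a <= r i, b <= s i - r i & c <= u i - s i].
    by split; [exact: fa|have := gb _ gsr i; rewrite !ffunE
              |have := hc _ hus i; rewrite !ffunE].
  by split=> i; rewrite !ffunE; have [ra rb rc] := E i; lia.
have inK r : \sum_(s \in M) G r s != 0 -> K r.
  apply: contra_neqP => nK; apply: fsbig1 => s _; apply/eqP.
  by apply: contra_notT nK => /GKM[].
have inM s : \sum_(r \in K) G r s != 0 -> M s.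
  apply: contra_neqP => nM; apply: fsbig1 => r _; apply/eqP.
  by apply: contra_notT nM => /GKM[].
transitivity (\sum_(r \in K) \sum_(s \in M) G r s).
  rewrite -(fsum_restrict inK); apply: eq_fsbigr => r _.
  rewrite lmulE mulr_fsumr -(fsum_restrict (fun s Gs => (GKM r s Gs).2)).
  rewrite (@reindex_fsbigT _ _ _ _ _ (fun t => t - r)); last first.
    by exists (fun t => t + r) => t; rewrite ?addrK ?subrK.
  apply: eq_fsbigr => s _; rewrite /G.
  have -> : u - r - (s - r) = u - s by rewrite opprB addrA subrK.
  have -> : u - r = (s - r) + (u - s) by rewrite [RHS]addrC addrA subrK.
  have -> : qcocycle s (u - s) = qcocycle r (u - s) * qcocycle (s - r) (u - s).
    by rewrite -qcocycleDl (_ : r + (s - r) = s) // addrC subrK.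
  rewrite (qcocycleDr r (s - r) (u - s)).
  have AC (x1 x2 x3 y1 y2 y3 : k) :
    x1 * x2 * y1 * (x3 * y2 * y3) = x1 * (x2 * x3) * y1 * y2 * y3 by ring.
  exact: AC.
rewrite exchange_fsbig // -(fsum_restrict inM); apply: eq_fsbigr => s _.
rewrite lmulE mulr_fsumr mulr_fsuml -(fsum_restrict (fun r Gr => (GKM r s Gr).1)).
by apply: eq_fsbigr => r _; rewrite /G; ring.
Qed.

Lemma lone_neq0 : lone != 0 :> L.
Proof.
apply/eqP => /(congr1 (fun f : L => f 0)) /=.
by rewrite /lmono_fun eqxx => /eqP; rewrite oner_eq0.
Qed.

HB.instance Definition _ :=
  GRing.Zmodule_isNzRing.Build L lmulA lmul1l lmul1r lmulDl lmulDr lone_neq0.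

(** The lemmas below are not needed for the definitions. They identify [L] with the
    localization of the power series ring at the [x_i]: scalars are central,
    [x_i x_j = q_ij x_j x_i], monomials are units, and every series becomes a power
    series after multiplication by a monomial. *)

Definition lexp (i : 'I_n) : exponent n := [ffun j => (j == i)%:R].
Definition lvar (i : 'I_n) : L := lmono 1 (lexp i).

Lemma lmonoM c d s t :
  lmono c s * lmono d t = lmono (qcocycle s t * c * d) (s + t).
Proof.
apply: qlaurentP => u; rewrite lmono_mull /= /lmono_fun.
have -> : (u - s == t) = (u == s + t) by rewrite subr_eq addrC.
by case: eqP => [->|_]; rewrite ?mulr0 // [s + t - s]addrC addKr.
Qed.

Lemma lmono_scalar_comm c (f : L) : lmono c 0 * f = f * lmono c 0.
Proof.
apply: qlaurentP => u.
by rewrite lmono_mull lmono_mulr subr0 qcocycle0l qcocycle0r !mul1r mulrC.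
Qed.

Lemma qcocycle_lexp i j : qcocycle (lexp i) (lexp j) = if (j < i)%N then q i j else 1.
Proof.
rewrite /qcocycle (bigD1 i) //= [X in _ * X]big1 ?mulr1; last first.
  by move=> a ai; rewrite big1 // => b _; rewrite ffunE (negPf ai) mul0r.
rewrite big_mkcond /= (bigD1 j) //= [X in _ * X]big1 ?mulr1; last first.
  by move=> b bj; rewrite !ffunE (negPf bj) mulr0 if_same.
by rewrite !ffunE !eqxx.
Qed.

Lemma lvarC i j : lvar i * lvar j = lmono (q i j) 0 * (lvar j * lvar i).
Proof.
rewrite !lmonoM !mulr1 qcocycle0l mul1r add0r [lexp j + _]addrC; congr lmono.
have [qii q0 qV] := hq; rewrite !qcocycle_lexp.
by case: ltngtP => [|ij|/val_inj->]; rewrite ?mulr1 ?qii // qV mulVf.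
Qed.

Lemma lmono_inv s : exists g : L, lmono 1 s * g = 1 /\ g * lmono 1 s = 1.
Proof.
have E : qcocycle s (- s) = qcocycle (- s) s.
  apply: (mulfI (qcocycle_neq0 s s)); rewrite -qcocycleDr subrr qcocycle0r.
  by rewrite mulrC -qcocycleDl addNr qcocycle0l.
exists (lmono (qcocycle s (- s))^-1 (- s)); rewrite !lmonoM addNr subrr -E !mulr1.
by rewrite mulfV ?qcocycle_neq0.
Qed.

Definition is_power_series (f : L) :=
  forall s : exponent n, (exists i, s i < 0) -> f s = 0.

Lemma qlaurent_frac (f : L) :
  exists m : nat, is_power_series (lmono 1 [ffun=> m%:Z] * f).
Proof.
have /asboolP[m fm] := coef_bounded f; exists `|m|%N => s [i si].
rewrite lmono_mull fm ?mulr0 //; exists i; rewrite !ffunE.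
by move: (s i) si => x; lia.
Qed.

End LaurentSeries.

(* Main.v *)
Require Import Defs.
From mathcomp Require Import all_boot all_order all_algebra.
From mathcomp Require Import ring zify.
From mathcomp Require Import all_classical topology.

(** An ideal [J] of [L] is generated by [J] intersected with [Z], and an ideal [Q]
    of [Z] satisfies [LQ] intersected with [Z] is [Q] (apply the [Z]-linear
    projection of [L] onto [Z] which truncates the support); for any ring these
    two facts give the homeomorphism.

    For the first, use standard bases with respect to the degree-lexicographic
    order. By Dickson's lemma finitely many power series in [J] have leading
    exponents dividing all leading exponents of power series in [J]; division by
    them shows that the power series in [J] form a closed set. Conjugations by
    monomials separate the cosets of the group of central exponents, so that
    modulo high degree every component [f_s] in [x^s Z] of [f] in [J] lies in
    [J], hence so does [f_s] by closedness. Replacing each member of the basis by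
    the component of its leading exponent gives a standard basis of elements of
    the form [x^s z] with [z] in [J] and central. *)

Set Implicit Arguments.
Unset Strict Implicit.
Unset Printing Implicit Defensive.

Import Order.TTheory GRing.Theory Num.Theory.
Local Open Scope classical_set_scope.
Local Open Scope ring_scope.

(** * Elementary facts on ideals and primes *)

Section IdealTheory.
Variable A : pzRingType.
Implicit Type I : set A.

Lemma ideal_sum I m (F : 'I_m -> A) :
  ideal I -> (forall i, I (F i)) -> I (\sum_(i < m) F i).
Proof. by case=> I0 ID _ IF; elim/big_ind: _. Qed.

Lemma eq_Spec (P P' : Spec A) : P = P' :> set A -> P = P'.
Proof.
case: P P' => [P pP] [P' pP'] /= PP'; move: pP'; rewrite -PP' => pP'.
by congr MkSpec; apply: Prop_irrelevance.
Qed.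

Lemma proper_ideal I : ideal I -> I <> setT <-> ~ I 1.
Proof.
case=> _ _ IM; split=> [IT I1|I1 IT]; last by apply: I1; rewrite IT.
apply: IT; apply/seteqP; split=> // a _.
by have [+ _] := IM a 1 I1; rewrite mulr1.
Qed.

End IdealTheory.

(** * Contraction to the center and extension back *)

Section Contraction.
Variable A : pzRingType.
Local Notation Z := (center A).
Implicit Types (I J P : set A) (Q : set Z).

Lemma center_comm (z : Z) (a : A) : val z * a = a * val z.
Proof. by have /asboolP := centerP z; apply. Qed.

Lemma contract_ideal I : ideal I -> ideal (contract I).
Proof.
case=> I0 ID IM; split=> //; first by move=> x y; apply: ID.
by move=> a x Ix; have [] := IM (val a) (val x) Ix.
Qed.

Lemma sub_extend Q (z : Z) : Q z -> extend Q (val z).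
Proof.
by move=> Qz; exists 1, (fun=> 1), (fun=> z); split=> //; rewrite big_ord1 mul1r.
Qed.

Lemma extend_sub Q I : ideal I -> Q `<=` contract I -> extend Q `<=` I.
Proof.
move=> idI QI _ [m [a [z [Qz ->]]]]; apply: ideal_sum => // i.
by have [_ _ IM] := idI; case: (IM (a i) _ (QI _ (Qz i))).
Qed.

Lemma extend_ideal Q : ideal (extend Q).
Proof.
split.
- by exists 0, (fun=> 0), (fun=> 0); split; [case|rewrite big_ord0].
- move=> _ _ [m [a [z [Qz ->]]]] [p [b [w [Qw ->]]]].
  exists (m + p)%N, (fun i => match fintype.split i with inl i => a i | inr i => b i end),
    (fun i => match fintype.split i with inl i => z i | inr i => w i end).
  split; first by move=> i; case: (fintype.split i).
  rewrite big_split_ord /=; congr (_ + _); apply: eq_bigr => i _.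
    by rewrite (unsplitK (inl i)).
  by rewrite (unsplitK (inr i)).
- move=> c _ [m [a [z [Qz ->]]]]; split.
    exists m, (fun i => c * a i), z; split=> //.
    by rewrite mulr_sumr; apply: eq_bigr => i _; rewrite mulrA.
  exists m, (fun i => a i * c), z; split=> //.
  by rewrite mulr_suml; apply: eq_bigr => i _; rewrite -!mulrA center_comm.
Qed.

(** Since [z] and [w] are central, [a z b w = a b z w]: if [I J] lies in the contraction, the
    product of the two extensions lies in [P], and primeness of [P] applies to them. *)
Lemma contract_prime P : prime_ideal P -> prime_ideal (contract P).
Proof.
case=> idP /eqP PT pP; have idC := contract_ideal idP; have [_ _ PM] := idP.
split=> //; first by apply/eqP/(proper_ideal idC)/(proper_ideal idP).
move=> I J idI idJ IJ.
have sub K : extend K `<=` P -> K `<=` contract P.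
  by move=> KP z Kz; apply: KP; apply: sub_extend.
have [||_ _ [m [a [z [Iz ->]]]] [p [b [w [Jw ->]]]]|/sub|/sub] :=
  pP (extend I) (extend J); [exact: extend_ideal|exact: extend_ideal| |by left|by right].
rewrite mulr_suml; apply: ideal_sum => // i; rewrite mulr_sumr.
apply: ideal_sum => // j.
rewrite mulrA -(mulrA (a i)) center_comm !mulrA -mulrA.
by have [] := PM (a i * b j) (val (z i) * val (w j)) (IJ _ _ (Iz i) (Jw j)).
Qed.

End Contraction.

(** * From the two ideal identities to the homeomorphism *)

Section SpecHomeo.
Variable A : pzRingType.
Local Notation Z := (center A).
Hypothesis contractK : forall I : set A, ideal I -> I `<=` extend (contract I).
Hypothesis extendK : forall Q : set Z, ideal Q -> contract (extend Q) `<=` Q.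

(** By [contractK], an ideal whose contraction lies in [Q] lies in [extend Q], so primeness can be
    tested on contractions. *)
Lemma extend_prime (Q : set Z) : prime_ideal Q -> prime_ideal (extend Q).
Proof.
case=> idQ /eqP QT pQ; split; first exact: extend_ideal.
  apply/eqP/(proper_ideal (extend_ideal Q)) => Q1.
  by move/(proper_ideal idQ): QT; apply; apply: extendK.
move=> I J idI idJ IJ.
have sub K : ideal K -> contract K `<=` Q -> K `<=` extend Q.
  move=> idK KQ; apply: subset_trans (contractK idK) _.
  by apply: extend_sub (extend_ideal _) _ => z /KQ; apply: sub_extend.
have [|||/sub|/sub] := pQ (contract I) (contract J).
- exact: contract_ideal.
- exact: contract_ideal.
- by move=> x y Ix Jy; apply: extendK => //; apply: IJ.
- by left; auto.
- by right; auto.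
Qed.

(** For continuity, the closed set of [J] pulls back under contraction to that of [extend J], and
    the closed set of [I] under extension to that of [contract I]. *)
Lemma Spec_center_homeo : exists (phi : Spec A -> Spec Z) (psi : Spec Z -> Spec A),
  [/\ forall P : Spec A, phi P = contract P :> set Z,
      forall Q : Spec Z, psi Q = extend Q :> set A,
      cancel phi psi /\ cancel psi phi,
      continuous phi
    & continuous psi].
Proof.
exists (fun P => MkSpec (contract_prime (Spec_prime P))),
  (fun Q => MkSpec (extend_prime (Spec_prime Q))); split=> //.
- split=> [P|Q]; apply: eq_Spec; apply/seteqP; split=> //=.
  + by have [idP _ _] := Spec_prime P; apply: extend_sub.
  + by have [idP _ _] := Spec_prime P; apply: contractK.
  + by have [idQ _ _] := Spec_prime Q; apply: extendK.
  + by move=> z; apply: sub_extend.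
- apply/continuousP => _ [J idJ ->]; exists (extend J); first exact: extend_ideal.
  apply/seteqP; split=> P /= JP; apply: contra_not JP => JP.
    by move=> z Jz; apply: JP; apply: sub_extend.
  by have [idP _ _] := Spec_prime P; apply: extend_sub.
- apply/continuousP => _ [I idI ->]; exists (contract I); first exact: contract_ideal.
  apply/seteqP; split=> Q /= IQ; apply: contra_not IQ => IQ.
    apply: subset_trans (contractK idI) _.
    by apply: extend_sub (extend_ideal _) _ => z /IQ; apply: sub_extend.
  by have [idQ _ _] := Spec_prime Q => z /IQ; apply: extendK.
Qed.

End SpecHomeo.

(** * Well-founded recursion and Dickson's lemma *)

Lemma wf_rec_exists (T V : Type) (R : T -> T -> Prop) (v0 : V)
    (F : T -> (T -> V) -> V) : well_founded R ->
  exists f, forall x, f x = F x (fun y => if `[< R y x >] then f y else v0).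
Proof.
move=> Rwf.
(* [Fix] supplies values only below [x]; extended by the default [v0] they form a plain function, as
   [F] expects. *)
pose G x (rec : forall y, R y x -> V) :=
  F x (fun y => if pselect (R y x) is left Ryx then rec y Ryx else v0).
exists (Fix Rwf (fun=> V) G) => x; rewrite Fix_eq; last first.
  move=> y f g fg; congr F; apply/funext => z.
  by case: pselect => // Rzy; apply: fg.
congr F; apply/funext => y.
by case: pselect => Ryx; [rewrite asboolT | rewrite asboolF].
Qed.

(** If [B] serves for the first [j] coordinates and [m] bounds all [b j], then [B] also covers every
    [a] with [a j >= m]; the remaining [a] lie in finitely many slices of constant [a j], each
    covered by induction. Comparing functions on all of [nat] only below [j] keeps the type
    fixed. *)
Lemma dickson (j : nat) (A : set (nat -> nat)) :
  exists B : seq (nat -> nat), (forall b, List.In b B -> A b) /\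
    forall a, A a -> exists2 b, List.In b B & forall i, (i < j)%N -> (b i <= a i)%N.
Proof.
elim: j A => [|j IH] A.
  have [[a Aa]|A0] := pselect (exists a, A a); last first.
    by exists [::]; split=> // a Aa; case: A0; exists a.
  by exists [:: a]; split=> [_ [<-|[]]//|c _]; exists a => //; left.
have slices m : exists B : seq (nat -> nat), (forall b, List.In b B -> A b) /\
    forall a, A a -> (a j < m)%N ->
      exists2 b, List.In b B & forall i, (i < j.+1)%N -> (b i <= a i)%N.
  elim: m => [|m [B [BA Bm]]]; first by exists [::].
  have [C [CA Cm]] := IH [set a | A a /\ a j = m].
  exists (B ++ C); split=> [b /(@List.in_app_or _ B C)[/BA|/CA[]]//|a Aa].
  rewrite ltnS leq_eqVlt => /predU1P[ajm|/(Bm a Aa)[b Bb ba]]; last first.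
    by exists b => //; apply/List.in_or_app; left.
  have [b Cb ba] := Cm a (conj Aa ajm).
  exists b => [|i]; first by apply/List.in_or_app; right.
  rewrite ltnS leq_eqVlt => /predU1P[->|/ba//].
  by have [_ ->] := CA _ Cb; rewrite ajm.
have [B [BA Bj]] := IH A.
have [m mB] : exists m, forall b, List.In b B -> (b j <= m)%N.
  elim: {BA Bj} B => [|b B [m mB]]; first by exists 0%N.
  by exists (maxn (b j) m) => c [<-|/mB]; rewrite leq_max ?leqnn // => ->; rewrite orbT.
have [C [CA Cm]] := slices m.
exists (B ++ C); split=> [b /(@List.in_app_or _ B C)[/BA|/CA]//|a Aa].
have [ajm|maj] := ltnP (a j) m.
  by have [b Cb ba] := Cm a Aa ajm; exists b => //; apply/List.in_or_app; right.
have [b Bb ba] := Bj a Aa; exists b => [|i]; first by apply/List.in_or_app; left.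
rewrite ltnS leq_eqVlt => /predU1P[->|/ba//].
exact: leq_trans (mB b Bb) maj.
Qed.

(** * The degree-lexicographic order on exponents *)

Section MonomialOrder.
Variable n : nat.
Implicit Types (s t u v w : exponent n) (A : set (exponent n)).

Definition degree u : int := \sum_i u i.

(** Keys are compared lexicographically: first the degree, then the coordinates, shifted by one;
    beyond the last coordinate the key is 0. *)
Definition deglex_key u (j : nat) : int :=
  if j is i.+1 then (if insub i is Some o then u o else 0) else degree u.

Definition deglex u v := exists2 i : nat, deglex_key u i < deglex_key v i
  & forall j, (j < i)%N -> deglex_key u j = deglex_key v j.

Definition nneg u := forall i, 0 <= u i.

Lemma degreeD u v : degree (u + v) = degree u + degree v.
Proof. by rewrite /degree -big_split; apply: eq_bigr => i _; rewrite ffunE. Qed.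

Lemma deglex_keyD u v j : deglex_key (u + v) j = deglex_key u j + deglex_key v j.
Proof.
case: j => [|j] /=; first exact: degreeD.
by case: insub => [o|]; rewrite ?ffunE ?addr0.
Qed.

Lemma deglex_irr u : ~ deglex u u.
Proof. by case=> i; rewrite ltxx. Qed.

Lemma deglex_asym u v : deglex u v -> ~ deglex v u.
Proof.
case=> i ui uvi [j vj vuj]; case: (ltngtP i j) => [ij|ji|ij].
- by move: ui; rewrite (vuj i ij) ltxx.
- by move: vj; rewrite (uvi j ji) ltxx.
- by move: vj; rewrite -ij ltNge (ltW ui).
Qed.

Lemma deglexD w u v : deglex u v -> deglex (w + u) (w + v).
Proof.
case=> i ui uvi; exists i; first by rewrite !deglex_keyD ltrD2l.
by move=> j ji; rewrite !deglex_keyD uvi.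
Qed.

Lemma deglex_degree u v : degree u < degree v -> deglex u v.
Proof. by move=> uv; exists 0%N. Qed.

Lemma nneg_deglex_key u j : nneg u -> 0 <= deglex_key u j.
Proof.
move=> u0; case: j => [|j] /=; first exact: sumr_ge0.
by case: insub => [o|].
Qed.

(** On nonnegative exponents the keys are nonnegative integers, so they can be minimized one after
    the other. *)
Lemma deglex_min A : A !=set0 -> A `<=` nneg ->
  exists2 s, A s & forall t, A t -> t = s \/ deglex s t.
Proof.
move=> [a Aa] A0.
have step j : exists2 s, A s & forall t, A t -> deglex s t \/
    forall i, (i < j)%N -> deglex_key s i = deglex_key t i.
  elim: j => [|j [s As sP]]; first by exists a => // t At; right.
  pose B := [set t | A t /\ forall i, (i < j)%N -> deglex_key s i = deglex_key t i].
  have exB : exists m, `[< exists2 t, B t & deglex_key t j = m%:Z >].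
    exists `|deglex_key s j|%N; apply/asboolP; exists s; first by split.
    by rewrite gez0_abs //; apply/nneg_deglex_key/A0.
  have keyB t : B t -> deglex_key t j = `|deglex_key t j|%N%:Z.
    by case=> At _; rewrite gez0_abs //; apply/nneg_deglex_key/A0.
  case: (ex_minnP exB) => m /asboolP[r [Ar sr] rm] mP; exists r => // t At.
  have [[i ij [sti sti']]|st] : (exists2 i, (i < j)%N & deglex_key s i < deglex_key t i /\
      forall l, (l < i)%N -> deglex_key s l = deglex_key t l) \/
      forall i, (i < j)%N -> deglex_key s i = deglex_key t i.
    have [[i si sti]|] := sP t At; last by right.
    have [ij|ji] := ltnP i j; first by left; exists i.
    by right=> l lj; apply: sti; apply: leq_trans ji.
  - left; exists i => [|l li]; first by rewrite -sr.
    by rewrite -sr ?sti' // (ltn_trans li).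
  - have Bt : B t by [].
    have rt i : (i < j)%N -> deglex_key r i = deglex_key t i.
      by move=> ij; rewrite -sr ?st.
    have : (m <= `|deglex_key t j|)%N.
      by apply: mP; apply/asboolP; exists t => //; apply: keyB.
    rewrite leq_eqVlt => /predU1P[mt|mt]; [right=> i|left; exists j => //].
      by rewrite ltnS leq_eqVlt => /predU1P[->|/rt//]; rewrite rm mt -keyB.
    by rewrite rm keyB.
(* Key 0 is the degree and keys 1 to [n] are the coordinates, so agreement on [n.+1] keys is
   equality. *)
have [s As sP] := step n.+1; exists s => // t /sP[|st]; first by right.
by left; apply/ffunP => i; have := st i.+1 (ltn_ord i); rewrite /= valK.
Qed.

(** Otherwise the nonnegative exponents that are not accessible would have a least element. *)
Lemma deglex_wf : well_founded (fun s t => [/\ nneg s, nneg t & deglex s t]).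
Proof.
move=> u; apply: contrapT => nAu.
have [s [s0 nAs] sP] : exists2 s, (nneg s /\ ~ Acc (fun s t => [/\ nneg s, nneg t & deglex s t]) s)
    & forall t, nneg t /\ ~ Acc (fun s t => [/\ nneg s, nneg t & deglex s t]) t -> t = s \/ deglex s t.
  apply: (@deglex_min [set s | nneg s /\ ~ Acc _ s]) => [|t []//].
  by exists u; split=> //; apply: contrapT => u0; apply: nAu; split=> t [].
apply: nAs; split=> t [t0 _ ts]; apply: contrapT => nAt.
have [tE|] := sP t (conj t0 nAt); last exact: deglex_asym.
by move: ts; rewrite tE; apply: deglex_irr.
Qed.

Lemma nneg_degree_le u (i : 'I_n) : nneg u -> u i <= degree u.
Proof. by move=> u0; rewrite /degree (bigD1 i) //= lerDl sumr_ge0. Qed.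

Lemma dickson_exponents A : A `<=` nneg -> exists m (e : 'I_m -> exponent n),
  (forall i, A (e i)) /\ forall a, A a -> exists i, nneg (a - e i).
Proof.
move=> A0.
pose h (a : exponent n) (i : nat) := if insub i is Some o then `|a o|%N else 0%N.
have [B [BA Bn]] := dickson n (h @` A).
have [m [e [eA eB]]] : exists m (e : 'I_m -> exponent n), (forall i, A (e i)) /\
    forall b, List.In b B -> exists i, b = h (e i).
  elim: B BA {Bn} => [|b B IH] BA.
    by exists 0%N, (fun=> 0); split=> [[]|b []].
  have [|m [e [eA eB]]] := IH; first by move=> c cB; apply: BA; right.
  have [a Aa ab] := BA b (or_introl erefl).
  exists m.+1, (fun i => if unlift ord0 i is Some j then e j else a); split.
    by move=> i; case: (unlift _ i).
  move=> c [<-|/eB[i ->]]; first by exists ord0; rewrite unlift_none.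
  by exists (lift ord0 i); rewrite liftK.
exists m, e; split=> // a Aa.
have [b Bb ba] := Bn (h a) (imageP _ Aa); have [i bE] := eB b Bb.
exists i => o; have := ba o (ltn_ord o); rewrite bE /h valK.
have := A0 _ Aa o; have := A0 _ (eA i) o; rewrite !ffunE; move: (a o) (e i o) => x y; lia.
Qed.

End MonomialOrder.

(** * Power series and their leading exponents *)

Section Series.
Variables (k : fieldType) (n : nat) (q : 'M[k]_n) (hq : mult_antisym q).
Local Notation L := (qlaurent hq).
Implicit Types (f g h : L) (s t u v w : exponent n) (c d : k).

Lemma coefB f g u : (f - g) u = f u - g u. Proof. by []. Qed.

Lemma coef_sum m (F : 'I_m -> L) u : (\sum_i F i : L) u = \sum_i F i u.
Proof.
elim: m F => [|m IH] F; first by rewrite !big_ord0.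
by rewrite !big_ord_recl -IH.
Qed.

Lemma nnegP f : is_power_series f <-> forall u, f u != 0 -> nneg u.
Proof.
split=> [f0 u fu i|f0 u [i ui]].
  by rewrite leNgt; apply: contra fu => ui; rewrite f0 //; exists i.
by apply/eqP; apply: contraLR ui => /f0/(_ i); rewrite -leNgt.
Qed.

Lemma lmul_single s u f g :
  (forall t, t != s -> f t != 0 -> g (u - t) = 0) ->
  lmul f g u = qcocycle q s (u - s) * f s * g (u - s).
Proof.
move=> fg; rewrite lmulE -(fsbig_widen [set s]) ?fsbig_set1 // => t [_ /eqP ts] /=.
by have [->|ft] := eqVneq (f t) 0; rewrite ?mulr0 ?mul0r // fg ?mulr0.
Qed.

Lemma lmul_neq0 u f g : lmul f g u != 0 -> exists2 s, f s != 0 & g (u - s) != 0.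
Proof.
move=> fgu; apply: contrapT => nex; move/eqP: fgu; apply; rewrite lmulE fsbig1 // => s _.
have [->|fs] := eqVneq (f s) 0; first by rewrite mulr0 mul0r.
have [->|gs] := eqVneq (g (u - s)) 0; first by rewrite mulr0.
by case: nex; exists s.
Qed.

Lemma power_seriesM f g :
  is_power_series f -> is_power_series g -> is_power_series (f * g).
Proof.
move=> /nnegP f0 /nnegP g0; apply/nnegP => u /lmul_neq0[s /f0 s0 /g0 us] i.
by have := us i; have := s0 i; rewrite !ffunE; move: (u i) (s i) => x y; lia.
Qed.

Lemma power_seriesB f g :
  is_power_series f -> is_power_series g -> is_power_series (f - g).
Proof. by move=> f0 g0 u ui; rewrite coefB f0 ?g0 ?subr0. Qed.

(** As usual for power series, the leading exponent is the least of the support. *)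
Definition leads f u := f u != 0 /\ forall v, f v != 0 -> v = u \/ deglex u v.

Lemma leads_exists f : is_power_series f -> f != 0 -> exists u, leads f u.
Proof.
move=> /nnegP f0 fn0.
have [||u fu uP] := @deglex_min n [set u | f u != 0] => //; last by exists u.
apply: contrapT => nex; move/eqP: fn0; apply; apply: qlaurentP => u.
by apply/eqP; apply: contrapT => fu; apply: nex; exists u; apply/negP.
Qed.

Lemma power_series_bounded (c : exponent n -> k) :
  (forall u, c u != 0 -> nneg u) -> c \in laurent_bounded (n := n).
Proof.
move=> c0; apply/asboolP; exists 0 => u [i ui].
by apply/eqP; apply: contraLR ui => /c0/(_ i); rewrite -leNgt.
Qed.

(** * Division by several series *)

Section Division.
Variables (m : nat) (g : 'I_m -> L) (e : 'I_m -> exponent n).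
Hypotheses (ge : forall i, leads (g i) (e i)) (e0 : forall i, nneg (e i)).

Let M u : option 'I_m := [pick i | `[< nneg (u - e i) >]].

Let MP u i : M u = Some i -> nneg (u - e i).
Proof. by rewrite /M; case: pickP => // j /asboolP uj [<-]. Qed.

Let Mnneg u i : M u = Some i -> nneg u.
Proof. by move=> Mu j; have ui := MP Mu; have := ui j; have := e0 i j; rewrite !ffunE; move: (u j) (e i j) => x y; lia. Qed.

(** The exponents divisible by some [x^(e i)] are split among the [g i] by [M];
    [a u] is the coefficient of the multiple of [g (M u)] used to correct the
    coefficient of [x^u], and is found by well-founded recursion on [u]. *)
Let quo_fun (a : exponent n -> k) i s :=
  if M (s + e i) == Some i then a (s + e i) else 0.

Let quo_bounded a i : quo_fun a i \in laurent_bounded (n := n).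
Proof.
apply: power_series_bounded => u; rewrite /quo_fun; case: (_ =P Some i) => [Mu _|]; last by rewrite eqxx.
by have := MP Mu; rewrite addrK.
Qed.

Let quo a i : L := QLaurent hq (quo_bounded a i).

Let quo_power_series a i : is_power_series (quo a i).
Proof.
apply/nnegP => u; rewrite /= /quo_fun; case: (_ =P Some i) => [Mu _|]; last by rewrite eqxx.
by have := MP Mu; rewrite addrK.
Qed.

(** The values of [a] that are available when [a u] is determined. *)
Let below (a : exponent n -> k) u v :=
  if `[< [/\ nneg v, nneg u & deglex v u] >] then a v else 0.

(** The linear system for [a] is triangular: beyond the values of [a] below [u], the coefficient at
    [u] involves at most [a u], with a nonzero factor. *)
Let quoM a i u : nneg u -> lmul (quo a i) (g i) u = lmul (quo (below a u) i) (g i) u +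
  (if M u == Some i then qcocycle q (u - e i) (e i) * a u * g i (e i) else 0).
Proof.
move=> u0; have -> : quo a i = quo (below a u) i + (quo a i - quo (below a u) i).
  by rewrite addrC subrK.
rewrite (lmulDl _ _ (g i)) Defs.coefD; congr (_ + _).
(* Only those [t] occur in the difference for which [t + e i] is nonnegative and not below [u]; as
   [e i] is least in the support of [g i], this leaves [t = u - e i]. *)
rewrite (lmul_single (s := u - e i)) => [|t tu].
  rewrite opprB addrCA subrr addr0 coefB /= /quo_fun subrK /below.
  case: (_ =P Some i) => [Mu|_]; last by rewrite subrr mulr0 mul0r.
  by rewrite asboolF ?subr0 // => -[_ _ /deglex_irr].
rewrite coefB /= /quo_fun /below; case: (_ =P Some i) => [Mt|_]; last by rewrite subrr eqxx.
case: asboolP => [_|nlt]; first by rewrite subrr eqxx.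
move=> _; apply/eqP; apply: contrapT => /negP gu.
have [_ /(_ _ gu)] := ge i; case=> [eu|/(deglexD t)].
  by move/eqP: tu; apply; rewrite -eu opprB addrCA subrr addr0.
rewrite [t + (u - t)]addrC subrK => tlt; apply: nlt; split=> //; exact: Mnneg Mt.
Qed.

Let quo_solve f : exists a, forall u i, M u = Some i ->
  (\sum_j quo a j * g j : L) u = f u.
Proof.
have [a aE] := @wf_rec_exists _ _ _ (0 : k) (fun u a => if M u is Some i
  then (f u - (\sum_j quo a j * g j : L) u) / (qcocycle q (u - e i) (e i) * g i (e i))
  else 0) (@deglex_wf n).
(* The function cut off by the recursion is [below a u]. *)
have {}aE u : a u = if M u is Some i
  then (f u - (\sum_j quo (below a u) j * g j : L) u) / (qcocycle q (u - e i) (e i) * g i (e i))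
  else 0 by rewrite {1}aE.
exists a => u i Mu; rewrite coef_sum.
under eq_bigr do rewrite (quoM _ _ (Mnneg Mu)).
rewrite big_split /= [X in _ + X](bigD1 i) //= Mu eqxx.
rewrite [X in _ + (_ + X)]big1 ?addr0 => [|j ji]; last first.
  by rewrite (_ : (Some i == Some j) = false) //; apply/negP => /eqP[ij]; rewrite ij eqxx in ji.
rewrite aE Mu coef_sum; set S := \sum_j _.
have [gei _] := ge i; have qei := qcocycle_neq0 hq (u - e i) (e i).
by field; apply/andP.
Qed.

(** The remainder stays in [T] and by [quo_solve] has no exponent divisible by some [x^(e i)],
    whereas every nonzero element of [T] has one; so it vanishes. Keeping [T] abstract permits
    division in the closure of an ideal before that closure is known to lie in the ideal. *)
Lemma division (T : set L) :
  (forall f a i, T f -> is_power_series a -> T (f - a * g i)) ->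
  (forall f, T f -> f != 0 -> exists u i, f u != 0 /\ nneg (u - e i)) ->
  forall f, T f -> exists a : 'I_m -> L, f = \sum_i a i * g i.
Proof.
move=> TB Tlead f Tf; have [a aE] := quo_solve f.
exists (quo a); apply/eqP; rewrite -subr_eq0; apply: contrapT => /negP r0.
have Tr : T (f - \sum_i quo a i * g i).
  elim/big_ind: _ (f) Tf => [h|x y IHx IHy h|i _ h Th]; first by rewrite subr0.
    by move=> Th; rewrite opprD addrA; apply/IHy/IHx.
  exact: TB.
have [u [i [ru ui]]] := Tlead _ Tr r0; move/eqP: ru; apply; rewrite coefB.
case Mu: (M u) => [j|]; first by rewrite (aE _ _ Mu) subrr.
by move: Mu; rewrite /M; case: pickP => // /(_ i) /asboolP.
Qed.

End Division.

(** * Central exponents and the projection onto the center *)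

Lemma qcocycleNr s t : qcocycle q s (- t) = (qcocycle q s t)^-1.
Proof.
apply: (mulfI (qcocycle_neq0 hq s t)).
by rewrite -qcocycleDr // subrr qcocycle0r divff ?qcocycle_neq0.
Qed.

(** The exponents [s] for which the monomial [x^s] is central. *)
Definition central_exponent s := forall t, qcocycle q s t = qcocycle q t s.

Lemma central_exponentB s t :
  central_exponent s -> central_exponent t -> central_exponent (s - t).
Proof.
move=> cs ct u; apply: (mulIf (qcocycle_neq0 hq t u)).
by rewrite -qcocycleDl // subrK cs ct -qcocycleDr // subrK.
Qed.

Lemma central_exponentD s t :
  central_exponent s -> central_exponent t -> central_exponent (s + t).
Proof. by move=> cs ct u; rewrite qcocycleDl // qcocycleDr // cs ct. Qed.

Lemma central_exponent0 : central_exponent 0.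
Proof. by move=> t; rewrite qcocycle0l qcocycle0r. Qed.

(** Commutation with [x^t] is read off at the coefficient of [x^(t+u)]; conversely, substituting
    [u - s] for [s] turns one convolution into the other. *)
Lemma is_centralP f :
  f \in @is_central L <-> forall u, f u != 0 -> central_exponent u.
Proof.
split=> [/asboolP fc u fu t|fc].
  have := congr1 (fun h : L => h (t + u)) (fc (lmono hq 1 t)).
  rewrite (lmono_mulr 1 t f) (lmono_mull 1 t f) [t + u]addrC addrK !mulr1.
  exact: mulIf.
apply/asboolP => g; apply: qlaurentP => u.
rewrite [LHS]lmulE [RHS]lmulE (@reindex_fsbigT _ _ _ _ _ (fun t => u - t)); last first.
  by exists (fun t => u - t) => t; rewrite opprB addrCA subrr addr0.
apply: eq_fsbigr => s _; rewrite subKr.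
have [->|/fc cus] := eqVneq (f (u - s)) 0; first by rewrite !mulr0 mul0r.
by rewrite cus mulrAC.
Qed.

Definition component_fun s f u := if `[< central_exponent (u - s) >] then f u else 0.

Lemma component_bounded s f : component_fun s f \in laurent_bounded (n := n).
Proof.
have /asboolP[m fm] := coef_bounded f; apply/asboolP; exists m => u um.
by rewrite /component_fun fm ?if_same.
Qed.

(** The part of [f] lying in [x^s Z]. *)
Definition component s f : L := QLaurent hq (component_bounded s f).

Lemma componentE s f u :
  component s f u = if `[< central_exponent (u - s) >] then f u else 0.
Proof. by []. Qed.

Lemma component_power_series s f :
  is_power_series f -> is_power_series (component s f).
Proof. by move=> f0 u ui; rewrite componentE f0 ?if_same. Qed.

Lemma component0_central f : component 0 f \in @is_central L.
Proof.
apply/is_centralP => u; rewrite componentE subr0.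
by case: asboolP => //; rewrite eqxx.
Qed.

Lemma component0_id z : z \in @is_central L -> component 0 z = z.
Proof.
move=> /is_centralP cz; apply: qlaurentP => u; rewrite componentE subr0.
by case: asboolP => // nu; apply/eqP; rewrite eq_sym; apply: contraTT isT => /cz.
Qed.

Lemma component0D f g : component 0 (f + g) = component 0 f + component 0 g.
Proof.
apply: qlaurentP => u; rewrite Defs.coefD !componentE.
by case: asboolP; rewrite ?addr0.
Qed.

Lemma component00 : component 0 0 = 0.
Proof. by apply: qlaurentP => u; rewrite componentE if_same. Qed.

(** Central exponents form a group: when [u - s] is central, [u] is central exactly if [s] is. Hence
    truncating the support commutes with multiplication by [z]. *)
Lemma component0M f z : z \in @is_central L -> component 0 (f * z) = component 0 f * z.
Proof.
move=> /is_centralP cz; apply: qlaurentP => u; rewrite componentE subr0 [RHS]lmulE.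
case: asboolP => cu; [rewrite [LHS]lmulE|apply/esym/fsbig1 => s _].
  apply: eq_fsbigr => s _; rewrite componentE subr0; case: asboolP => // ncs.
  have [->|/cz cus] := eqVneq (z (u - s)) 0; first by rewrite !mulr0.
  by case: ncs; rewrite -[s](subKr u); apply: central_exponentB.
rewrite componentE subr0; case: asboolP => [cs|_]; last by rewrite mulr0 mul0r.
have [->|/cz cus] := eqVneq (z (u - s)) 0; first by rewrite mulr0.
by case: cu; rewrite -[u](subrK s); apply: central_exponentD.
Qed.

Lemma contract_extend (Q : set (center L)) : ideal Q -> contract (extend Q) `<=` Q.
Proof.
move=> idQ x [m [a [z [Qz xE]]]]; have [_ _ QM] := idQ.
(* [component 0] fixes [x] and replaces each [a i] by a central element. *)
have -> : x = \sum_i Center (component0_central (a i)) * z i.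
  apply: val_inj; rewrite raddf_sum /= -(component0_id (centerP x)) xE.
  have -> : component 0 (\sum_i a i * val (z i)) = \sum_i component 0 (a i * val (z i)).
    exact: (big_morph _ component0D component00).
  by apply: eq_bigr => i _; apply/component0M/centerP.
by apply: ideal_sum => // i; have [] := QM (Center (component0_central (a i))) _ (Qz i).
Qed.

(** * Ideals of the Laurent series ring are generated by central elements *)

Section ExtendContract.
Variable J : set L.
Hypothesis idJ : ideal J.

Let JD f g : J f -> J g -> J (f + g). Proof. by case: idJ => _ + _; apply. Qed.
Let JMl f g : J g -> J (f * g). Proof. by case: idJ => _ _ JM /(JM f)[]. Qed.
Let JMr f g : J f -> J (f * g). Proof. by case: idJ => _ _ JM /(JM g)[]. Qed.
Let JB f g : J f -> J g -> J (f - g).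
Proof. by move=> Jf Jg; rewrite -[g]mul1r -mulNr; apply/JD/JMl. Qed.

(** Conjugation by [x^t] scales the coefficient of [x^u] by [chi u], so that
    subtracting [chi b] times [f] kills the coefficient of [x^b]. *)
Lemma kill_exponent s b f : J f -> ~ central_exponent (b - s) ->
  exists g, [/\ J g, forall u, f u = 0 -> g u = 0, g b = 0
    & forall u, central_exponent (u - s) -> g u = f u].
Proof.
move=> Jf /existsNP[t tbs].
have q0 u v := qcocycle_neq0 hq u v.
(* [chi] is a character of the group of exponents, trivial on the central ones; the choice of [t]
   gives [chi b != chi s]. *)
pose chi u := qcocycle q t u / qcocycle q u t.
have chiD u v : chi (u + v) = chi u * chi v.
  by rewrite /chi qcocycleDl // qcocycleDr //; field; rewrite !q0.
have chi0 u : chi u != 0 by rewrite mulf_neq0 ?invr_neq0.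
have chi_central u : central_exponent u -> chi u = 1.
  by move=> cu; rewrite /chi cu divff.
have chi_bs : chi b != chi s.
  rewrite -[b](subrK s) chiD -subr_eq0 -{2}[chi s]mul1r -mulrBl mulf_neq0 // subr_eq0.
  apply/eqP => /(congr1 (fun x => x * qcocycle q (b - s) t)).
  by rewrite mul1r /chi mulfVK // => E; apply: tbs.
(* The scalar [qcocycle q t t] makes the monomial on the right the inverse of [x^t]. *)
pose h : L := lmono hq 1 t * f * lmono hq (qcocycle q t t) (- t) - lmono hq (chi b) 0 * f.
have hE u : h u = (chi u - chi b) * f u.
  rewrite coefB [X in X - _]lmono_mulr [X in _ - X]lmono_mull opprK.
  rewrite [X in _ * X * _](lmono_mull 1 t f) subr0 qcocycle0l [u + t]addrC addrAC subrr add0r.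
  by rewrite qcocycleNr qcocycleDl // /chi; field; rewrite !q0.
(* On the coset of [s], [h] is [f] times [chi s - chi b]; this scalar is divided out. *)
exists (lmono hq (chi s - chi b)^-1 0 * h).
have gE u : (lmono hq (chi s - chi b)^-1 0 * h : L) u = (chi u - chi b) / (chi s - chi b) * f u.
  by rewrite [LHS]lmono_mull subr0 qcocycle0l mul1r hE mulrCA mulrA.
split=> [|u fu||u cu].
- by apply: JMl; apply: JB; [apply/JMr/JMl|apply: JMl].
- by rewrite gE fu mulr0.
- by rewrite gE subrr mul0r mul0r.
- rewrite gE -[u](subrK s) chiD (chi_central _ cu) mul1r divff ?mul1r //.
  by rewrite subr_eq0 eq_sym.
Qed.

(** The closure of [J] among power series, in the topology given by the total degree. *)
Let closure : set L := [set f | is_power_series f /\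
  forall N : int, exists h, [/\ J h, is_power_series h & forall u, degree u < N -> h u = f u]].

(** The nonnegative exponents of degree below [N] lie in a finite box; those outside the coset of
    [s] are killed one by one. Zero coefficients stay zero, so no earlier step is undone. *)
Lemma component_closure s f : J f -> is_power_series f -> closure (component s f).
Proof.
move=> Jf f0; split=> [|N]; first exact: component_power_series.
have kill (B : seq (exponent n)) : exists g, [/\ J g, forall u, f u = 0 -> g u = 0,
    forall b, b \in B -> ~ central_exponent (b - s) -> g b = 0
    & forall u, central_exponent (u - s) -> g u = f u].
  elim: B => [|b B [g [Jg g0 gB gs]]]; first by exists f.
  have [cb|ncb] := pselect (central_exponent (b - s)).
    exists g; split=> // c; rewrite inE => /predU1P[->//|]; exact: gB.
  have [h [Jh h0 hb hs]] := kill_exponent Jg ncb.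
  exists h; split=> // [u /g0/h0//|c|u cu]; last by rewrite hs ?gs.
  by rewrite inE => /predU1P[->//|cB nc]; apply/h0/gB.
have /finite_seqP[B BE] := finite_box (n := n) 0 [ffun=> N].
have [g [Jg g0 gB gs]] := kill B.
exists g; split=> [//|u ui|u uN]; first by rewrite g0 ?f0.
rewrite componentE; case: asboolP => [/gs//|ncu].
have [u0|nu0] := pselect (nneg u).
  apply: gB => //; suff: [set` B] u by [].
  rewrite -BE => i /=; rewrite !ffunE u0 /=.
  by apply: le_trans (nneg_degree_le i u0) (ltW uN).
by apply/g0/f0; move/existsNP: nu0 => [i /negP]; rewrite -ltNge; exists i.
Qed.

Let closureB m (g : 'I_m -> L) : (forall i, J (g i)) -> (forall i, is_power_series (g i)) ->
  forall f a i, closure f -> is_power_series a -> closure (f - a * g i).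
Proof.
move=> Jg g0 f a i [f0 fN] a0; split.
  by apply: power_seriesB => //; apply: power_seriesM.
move=> N; have [h [Jh h0 hN]] := fN N; exists (h - a * g i); split.
- by apply/JB/JMl.
- by apply: power_seriesB => //; apply: power_seriesM.
- by move=> u uN; rewrite !coefB hN.
Qed.

Lemma sub_extend_contract : J `<=` extend (contract J).
Proof.
pose A := [set u | exists f, [/\ J f, is_power_series f & leads f u]].
have A0 : A `<=` @nneg n by move=> u [f [_ /nnegP f0 [/f0]]].
have [m [e [eA eP]]] := dickson_exponents A0.
have [g gP] := choice eA.
(* An element of [J] that agrees with [f] up to and including the degree of the leading exponent [u]
   of [f] has the same leading exponent, so [u] lies in [A]. *)
have cover f : closure f -> f != 0 -> exists u i, f u != 0 /\ nneg (u - e i).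
  case=> f0 fN fn0; have [u [fu ulead]] := leads_exists f0 fn0.
  have [h [Jh h0 hN]] := fN (degree u + 1).
  have [|i ui] := eP u; last by exists u, i.
  exists h; split=> //; split=> [|v hv]; first by rewrite hN ?ltrDl.
  have [uv|vu] := ltP (degree u) (degree v); first by right; apply: deglex_degree.
  by apply: ulead; rewrite -hN // ltzD1.
have closureJ : closure `<=` J.
  move=> f cf; have [|||a ->] := @division m g e _ _ closure _ cover f cf.
  - by move=> i; have [] := gP i.
  - by move=> i; apply: A0.
  - by apply: closureB => i; have [] := gP i.
  - by apply: ideal_sum => // i; have [Jg _ _] := gP i; apply: JMl.
pose g' i := component (e i) (g i).
(* A component is at first known only to lie in the closure; division by the [g i] has brought the
   closure into [J]. *)
have Jg' i : J (g' i) by have [Jg g0 _] := gP i; apply/closureJ/component_closure.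
have g'0 i : is_power_series (g' i) by have [_ g0 _] := gP i; apply: component_power_series.
have g'lead i : leads (g' i) (e i).
  have [_ _ [gei glead]] := gP i; split.
    by rewrite componentE subrr asboolT //; apply: central_exponent0.
  by move=> v; rewrite componentE; case: asboolP => [_ /glead//|]; rewrite eqxx.
have Jclosure f : J f -> is_power_series f -> closure f.
  by move=> Jf f0; split=> // N; exists f.
have [_ extD extM] := extend_ideal (contract J).
have ext_ps f : J f -> is_power_series f -> extend (contract J) f.
  move=> Jf f0.
  (* The [g' i] have the same leading exponents as the [g i], so [cover] serves again. *)
  have [|||a ->] := @division m g' e _ _ closure _ cover f (Jclosure f Jf f0) => //.
  - by move=> i; apply: A0.
  - exact: closureB.
  apply: ideal_sum => [|i]; first exact: extend_ideal.
  (* Shifting by [- e i] moves the support of [g' i] into the central exponents; the scalar is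
     chosen so that [g' i] is [x^(e i)] times [z]. *)
  pose z := lmono hq (qcocycle q (e i) (e i)) (- e i) * g' i.
  have zc : z \in @is_central L.
    apply/is_centralP => u; rewrite [z u]lmono_mull.
    rewrite mulf_eq0 => /norP[_]; rewrite componentE opprK addrK.
    by case: asboolP => //; rewrite eqxx.
  have -> : g' i = lmono hq 1 (e i) * z.
    rewrite mulrA lmonoM subrr qcocycleNr mulr1 mulVf ?qcocycle_neq0 //.
    exact/esym/mul1r.
  have [+ _] := extM (a i) _ ((extM (lmono hq 1 (e i)) _
     (@sub_extend _ (contract J) (Center zc) (JMl _ (Jg' i)))).1).
  by [].
(* Multiplication by an invertible monomial reduces any [f] in [J] to a power series. *)
move=> f Jf; have [p fp] := qlaurent_frac f.
have [y [_ yx]] := lmono_inv hq [ffun=> p%:Z].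
rewrite -[f]mul1r -yx -mulrA.
by have [] := extM y _ (ext_ps _ (JMl _ Jf) fp).
Qed.

End ExtendContract.
End Series.

Theorem proposition3p14 (k : fieldType) (n : nat) (hn : (1 <= n)%N)
    (q : 'M[k]_n) (hq : mult_antisym q) :
  let L := qlaurent hq in
  let Z := center L in
  exists (phi : Spec L -> Spec Z) (psi : Spec Z -> Spec L),
    [/\ forall P : Spec L, phi P = contract P :> set Z,
        forall Q : Spec Z, psi Q = extend Q :> set L,
        cancel phi psi /\ cancel psi phi,
        continuous phi
      & continuous psi].
Proof.
apply: Spec_center_homeo; first by move=> I; apply: sub_extend_contract.
by move=> Q; apply: contract_extend.
Qed.
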